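(* Let $\diamondsuit\in\{\varnothing,\square,\mathsf h,\mathsf v\}$, let $\lambda$ be a partition and $\mathbf L=(L_i^{(a)})_{a,i\in\mathbb Z_{>0}}$ a matrix of nonnegative integers with finitely many nonzero entries. If the rank $n$ is sufficiently large (depending on $\lambda$ and $\mathbf L$), the fermionic formula $M(\lambda,\mathbf L;q)$ of a nonexceptional affine algebra $\mathfrak g$ depends only on the kind $\diamondsuit$ of $\mathfrak g$: there is $N$ such that for any two nonexceptional affine algebras $\mathfrak g,\mathfrak g'$ of kind $\diamondsuit$ with rank indices $n,n'\ge N$, the polynomials $M(\lambda,\mathbf L;q)$ computed for $\mathfrak g$ and for $\mathfrak g'$ coincide.
   Context: **Kinds.** Kind $\varnothing$: $A_n^{(1)}$; kind $\square$: $D_{n+1}^{(2)},A_{2n}^{(2)}$; kind $\mathsf h$: $C_n^{(1)}$; kind $\mathsf v$: $A_{2n-1}^{(2)},B_n^{(1)},D_n^{(1)}$. **Setting.** Kac's labelling of Dynkin nodes $I=\{0,\dots,n\}$ is used (for $A_{2n}^{(2)}$ removing node $0$ gives $C_n$), $I_0=\{1,\dots,n\}$. The classical subalgebra $\overset{\circ}{\mathfrak g}$ (remove node $0$) has type $A_n,B_n,C_n,D_n$ for $A_n^{(1)},B_n^{(1)},C_n^{(1)},D_n^{(1)}$, type $C_n$ for $A_{2n}^{(2)},A_{2n-1}^{(2)}$, type $B_n$ for $D_{n+1}^{(2)}$; fundamental weights $\overline\Lambda_a$. A partition $\lambda$ with few rows compared with $n$ is identified with $\sum_jm_j\overline\Lambda_j$,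 $m_j$ the number of columns of height $j$. Let $\overline{\mathfrak g}=\overset{\circ}{\mathfrak g}$, except $\overline{\mathfrak g}=B_n$ for $A_{2n}^{(2)}$; $\tilde\alpha_a,\tilde\Lambda_a$ are its simple roots and fundamental weights; the form is normalized so that long roots of $\overline{\mathfrak g}$ have square length $2r$ ($r=1$ for untwisted, $r=2$ for twisted types). $\iota(\overline\Lambda_a)=\epsilon_a\tilde\Lambda_a$ with $\epsilon_a=2$ if $\mathfrak g=A_{2n}^{(2)},a=n$ and $1$ otherwise. $t_a=1$ except $t_n=2$ for $B_n^{(1)}$ and $t_a=2$ ($a<n$) for $C_n^{(1)}$; $t_a^\vee=1$ except $t_n^\vee=2$ for $A_{2n-1}^{(2)}$, $t_a^\vee=2$ ($a<n$) for $D_{n+1}^{(2)}$, and $t_a^\vee=2$ (all $a$) for $A_{2n}^{(2)}$. **Fermionic formula.** For a matrix $\nu=(m_i^{(a)})_{a\in I_0,i>0}$ of nonnegative integers: $\nu$ is a $\lambda$-configuration if $\sum i\,m_i^{(a)}\tilde\alpha_a=\iota(\sum i\,L_i^{(a)}\overline\Lambda_a-\lambda)$; it is $\mathbf L$-admissible if all $p_i^{(a)}\ge0$, where $$p_i^{(a)}=\sum_{k>0}\Bigl(L_k^{(a)}\min(i,k)-\tfrac1{t_a^\vee}\sum_{b\in I_0}(\tilde\alpha_a|\tilde\alpha_b)\min(t_bi,t_ak)m_k^{(b)}\Bigr).$$ $C(\lambda,\mathbf L)$ is the set of $\mathbf L$-admissible $\lambda$-configurations, $$c(\nu)=\tfrac12\sum_{a,b}\sum_{j,k}(\tilde\alpha_a|\tilde\alpha_b)\min(t_bj,t_ak)m_j^{(a)}m_k^{(b)}-\sum_at_a^\vee\sum_{j,k}\min(j,k)L_j^{(a)}m_k^{(a)},$$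 $$M(\lambda,\mathbf L;q)=\sum_{\nu\in C(\lambda,\mathbf L)}q^{c(\nu)}\prod_{a\in I_0}\prod_{i>0}\begin{bmatrix}p_i^{(a)}+m_i^{(a)}\\ m_i^{(a)}\end{bmatrix}_{q^{t_a^\vee}}.$$ *)

(* Defs.v *)
(* Libraries: MathComp, with finmap for finitely supported matrices and
   mathcomp-classical for sums over the (finite) set of configurations. *)
From HB Require Import structures.
From mathcomp Require Import all_boot all_order all_algebra finmap.
From mathcomp Require Import classical_sets cardinality fsbigop.
From mathcomp Require Import ring.

Set Implicit Arguments.
Unset Strict Implicit.
Unset Printing Implicit Defensive.

Import Order.TTheory GRing.Theory Num.Theory.
Local Open Scope ring_scope.

(* AffA: A_n^(1), AffB: B_n^(1), AffC: C_n^(1), AffD: D_n^(1),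
   TwAodd: A_{2n-1}^(2), TwAeven: A_{2n}^(2), TwD: D_{n+1}^(2). *)
Inductive family := AffA | AffB | AffC | AffD | TwAodd | TwAeven | TwD.

Definition min_rank (X : family) : nat :=
  match X with
  | AffA => 1 | AffB => 3 | AffC => 2 | AffD => 4
  | TwAodd => 3 | TwAeven => 1 | TwD => 2
  end.

Record affine := Affine {
  fam : family;
  rk : nat;
  rk_ge : (min_rank fam <= rk)%N
}.

Inductive kind := KEmpty | KSquare | KH | KV.

Definition kind_of (X : family) : kind :=
  match X with
  | AffA => KEmpty
  | TwD | TwAeven => KSquare
  | AffC => KH
  | TwAodd | AffB | AffD => KV
  end.

(* Dynkin nodes are numbered from 1 throughout. *)
Definition inI0 (n a : nat) : bool := (1 <= a <= n)%N.

Inductive gtype := FinA | FinB | FinC | FinD.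

(* The type of gbar: that of the diagram without node 0, except for
   A_{2n}^(2), where it is B_n instead of C_n. *)
Definition gbar (X : family) : gtype :=
  match X with
  | AffA => FinA
  | AffB | TwAeven | TwD => FinB
  | AffC | TwAodd => FinC
  | AffD => FinD
  end.

(* The entry <alpha_a^vee, alpha_b> of the Cartan matrix of rank n: node n is
   short for type B, long for type C, and joined to node n-2 for type D. *)
Definition cartan (T : gtype) (n a b : nat) : int :=
  let adj := (a.+1 == b) || (b.+1 == a) in
  if a == b then 2 else
  match T with
  | FinA => - adj%:Z
  | FinB => if a == n then - adj%:Z *+ 2 else - adj%:Z
  | FinC => if b == n then - adj%:Z *+ 2 else - adj%:Z
  | FinD => if a == n then - (b.+2 == n)%:Z
            else if b == n then - (a.+2 == n)%:Z
            else - adj%:Z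
  end.

Definition long_root (T : gtype) (n a : nat) : bool :=
  match T with
  | FinA | FinD => true
  | FinB => (a < n)%N
  | FinC => a == n
  end.

(* Long roots of gbar have square length 2 r, with r as follows. *)
Definition rsq (X : family) : nat :=
  match X with
  | AffA | AffB | AffC | AffD => 1
  | TwAodd | TwAeven | TwD => 2
  end.

(* (alpha_a | alpha_a); the ratio of square lengths is 2 in types B and C. *)
Definition sqlen (X : family) (n a : nat) : rat :=
  if long_root (gbar X) n a then 2 * (rsq X)%:R else (rsq X)%:R.

(* (alpha_a | alpha_b) = <alpha_a^vee, alpha_b> (alpha_a | alpha_a) / 2 *)
Definition form (X : family) (n a b : nat) : rat :=
  (cartan (gbar X) n a b)%:~R * sqlen X n a / 2.

(* t_a *)
Definition tch (X : family) (n a : nat) : nat :=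
  match X with
  | AffB => if a == n then 2 else 1
  | AffC => if (a < n)%N then 2 else 1
  | _ => 1
  end.

(* t_a^vee *)
Definition tvee (X : family) (n a : nat) : nat :=
  match X with
  | TwAodd => if a == n then 2 else 1
  | TwD => if (a < n)%N then 2 else 1
  | TwAeven => 2
  | _ => 1
  end.

(* Weights are row vectors of coordinates on the fundamental weights, the
   coordinate on the fundamental weight of node a having index a.-1. *)
Definition fundwt (n a : nat) : 'rV[int]_n := \row_(j < n) (j.+1 == a)%:R.

Definition simple_root (X : family) (n a : nat) : 'rV[int]_n :=
  \row_(j < n) cartan (gbar X) n j.+1 a.

Definition eps (X : family) (n a : nat) : nat :=
  match X with TwAeven => if a == n then 2 else 1 | _ => 1 end.

Definition iota_wt (X : family) (n : nat) (w : 'rV[int]_n) : 'rV[int]_n :=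
  \sum_(j < n) w 0 j *: (fundwt n j.+1 *+ eps X n j.+1).

Definition is_partition (lam : seq nat) : bool :=
  sorted geq lam && (0%N \notin lam).

(* The number of columns of height j; column c meets the rows longer than c. *)
Definition ncols (lam : seq nat) (j : nat) : nat :=
  count (fun c => count (fun r => (c < r)%N) lam == j) (iota 0 (head 0%N lam)).

Definition part_wt (n : nat) (lam : seq nat) : 'rV[int]_n :=
  \sum_(1 <= j < n.+1) fundwt n j *+ ncols lam j.

(* L (a, i) is L_i^(a), and likewise nu (a, i) is m_i^(a). *)
Definition nmatrix := {fsfun nat * nat -> nat with 0%N}.

Definition vacancy (X : family) (n : nat) (L nu : nmatrix) (a i : nat) : rat :=
  (\sum_(x <- finsupp L | x.1 == a) L x * minn i x.2)%N%:R
  - (tvee X n a)%:R^-1 *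
    \sum_(x <- finsupp nu)
      form X n a x.1 * (minn (tch X n x.1 * i) (tch X n a * x.2) * nu x)%N%:R.

(* The support condition makes nu a matrix indexed by I_0 and i > 0. No such
   condition is needed on L: its entries at a = 0 or i = 0 are never used. *)
Definition is_config (X : family) (n : nat) (lam : seq nat) (L nu : nmatrix) :
    Prop :=
  (forall x, x \in finsupp nu -> inI0 n x.1 && (0 < x.2)%N) /\
  \sum_(x <- finsupp nu) simple_root X n x.1 *+ (x.2 * nu x)
  = iota_wt X (\sum_(x <- finsupp L | inI0 n x.1) fundwt n x.1 *+ (x.2 * L x)
               - part_wt n lam).

Definition is_admissible (X : family) (n : nat) (L nu : nmatrix) : Prop :=
  forall a i, inI0 n a -> (0 < i)%N -> 0 <= vacancy X n L nu a i.

Definition configs (X : family) (n : nat) (lam : seq nat) (L : nmatrix) :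
    set nmatrix :=
  [set nu | is_config X n lam L nu /\ is_admissible X n L nu]%classic.

Definition charge (X : family) (n : nat) (L nu : nmatrix) : rat :=
  2^-1 * (\sum_(x <- finsupp nu) \sum_(y <- finsupp nu)
    form X n x.1 y.1 *
    (minn (tch X n y.1 * x.2) (tch X n x.1 * y.2) * nu x * nu y)%N%:R)
  - (\sum_(x <- finsupp L) \sum_(y <- finsupp nu | y.1 == x.1)
      tvee X n x.1 * (minn x.2 y.2 * L x * nu y))%N%:R.

Lemma form_tch_int X n a b i k : inI0 n a -> inI0 n b ->
  exists z : int, form X n a b * (minn (tch X n b * i) (tch X n a * k))%N%:R
                  = z%:~R * (tvee X n a)%:R.
Proof.
move=> /andP[_ an] /andP[_ bn]; rewrite /form /sqlen.
have two0 : (2 : rat) != 0 by [].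
have half (z : int) (c m : nat) : z%:~R * (2 * c%:R) / 2 * m%:R
    = (z * m%:Z)%:~R * c%:R :> rat.
  by rewrite rmorphM /= -pmulrn; field.
have halfe (z : int) (c m : nat) : (z *+ 2)%:~R * c%:R / 2 * m%:R
    = (z * m%:Z)%:~R * c%:R :> rat.
  by rewrite !rmorphM !rmorphMn /= -pmulrn; field.
have halfm (z : int) (m p : nat) : z%:~R * 1%:R / 2 * (minn (2 * m) (2 * p))%:R
    = (z * (minn m p)%:Z)%:~R * 1%:R :> rat.
  by rewrite -minnMr natrM rmorphM /= -pmulrn; field.
have halft (z : int) (m : nat) : z%:~R * 2%:R / 2 * m%:R
    = (z * m%:Z)%:~R * 1%:R :> rat.
  by rewrite rmorphM /= -pmulrn; field.
case: X => /=.
- by eexists; exact: half.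
- case: (ltnP a n) => an'; first by eexists; exact: half.
  have -> : a = n by apply/eqP; rewrite eqn_leq an an'.
  rewrite /cartan eqxx; case: (n == b) => /=; last by eexists; exact: halfe.
  by exists ((minn (tch AffB n b * i) (2 * k))%:Z); rewrite -pmulrn /=; field.
- case: (eqVneq a n) => [->|an']; first by eexists; exact: half.
  have -> : (a < n)%N by rewrite ltn_neqAle an' an.
  case: (ltnP b n) => bn'; first by eexists; exact: halfm.
  have -> : b = n by apply/eqP; rewrite eqn_leq bn bn'.
  by rewrite /cartan (negPf an') eqxx; eexists; exact: halfe.
- by eexists; exact: half.
- case: (eqVneq a n) => [->|an']; first by eexists; exact: half.
  by eexists; exact: halft.
- case: (ltnP a n) => an'; first by eexists; exact: half.
  have -> : a = n by apply/eqP; rewrite eqn_leq an an'.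
  rewrite /cartan eqxx; case: (n == b) => /=; last by eexists; exact: halfe.
  by eexists; exact: (halfe 1).
- case: (ltnP a n) => an'; first by eexists; exact: half.
  by eexists; exact: halft.
Qed.

Lemma vacancy_int X n (L nu : nmatrix) a i : inI0 n a ->
  (forall x, x \in finsupp nu -> inI0 n x.1 && (0 < x.2)%N) ->
  vacancy X n L nu a i \is a Num.int.
Proof.
move=> an nuI; rewrite rpredB ?natr_int // mulr_sumr big_seq rpred_sum // => x xnu.
have /andP[xn _] := nuI _ xnu.
have [z] := form_tch_int X i x.2 an xn; rewrite natrM mulrA => ->.
have tv0 : (tvee X n a)%:R != 0 :> rat by case: X {z} => //=; case: ifP.
by rewrite mulrA mulrCA mulVf // mulr1 rpredM ?intr_int ?natr_int.
Qed.


Lemma form_sym X n a b : inI0 n a -> inI0 n b -> form X n a b = form X n b a.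
Proof.
move=> /andP[_ an] /andP[_ bn]; rewrite /form /sqlen.
have ltE c : (c <= n)%N -> (c < n)%N = (c != n) by move=> cn; rewrite ltn_neqAle cn andbT.
case: (eqVneq a b) => [-> //|ab].
rewrite /cartan [b == a]eq_sym (negPf ab) [(b.+1 == a) || _]orbC.
by case: X => /=; rewrite ?ltE //; case: (eqVneq a n) => [a_n|_];
  case: (eqVneq b n) => [b_n|_] //=; do ?[by move: ab; rewrite a_n b_n eqxx];
  rewrite ?rmorphMn /=; field.
Qed.

Lemma form_diag X n a i k : inI0 n a ->
  form X n a a / 2 * (minn (tch X n a * i) (tch X n a * k))%N%:R \is a Num.int.
Proof.
move=> /andP[_ an]; rewrite -minnMr natrM mulrA rpredM ?natr_int //.
rewrite /form /sqlen /cartan eqxx.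
case: X => //=; case: (ltngtP a n) an => //= _ _; by [].
Qed.

Lemma half_sum_int (T : eqType) (s : seq T) (F : T -> T -> rat) :
  {in s &, forall x y, F x y = F y x} ->
  {in s &, forall x y, F x y \is a Num.int} ->
  {in s, forall x, F x x / 2 \is a Num.int} ->
  2^-1 * (\sum_(x <- s) \sum_(y <- s) F x y) \is a Num.int.
Proof.
elim: s => [|z s IHs] symF intF diagF; first by rewrite big_nil mulr0.
have sub x : x \in s -> x \in z :: s by move=> xs; rewrite in_cons xs orbT.
have zs : z \in z :: s by rewrite mem_head.
have -> : \sum_(x <- z :: s) \sum_(y <- z :: s) F x y
    = F z z + (\sum_(y <- s) F z y) * 2 + \sum_(x <- s) \sum_(y <- s) F x y.
  under eq_bigr do rewrite big_cons.
  rewrite big_cons big_split /= [\sum_(i <- s) F i z](eq_big_seq (F z)).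
    by ring.
  by move=> x xs; apply: symF => //; exact: sub.
rewrite mulrDr rpredD //; last first.
  by apply: IHs => [x y xs ys|x y xs ys|x xs];
    [apply: symF|apply: intF|apply: diagF]; rewrite ?sub.
rewrite mulrDr rpredD //; first by rewrite mulrC diagF.
rewrite mulrCA mulVf // mulr1 big_seq rpred_sum // => y ys.
by apply: intF => //; exact: sub.
Qed.

Lemma charge_int X n (L nu : nmatrix) :
  (forall x, x \in finsupp nu -> inI0 n x.1 && (0 < x.2)%N) ->
  charge X n L nu \is a Num.int.
Proof.
move=> nuI; rewrite /charge; apply: rpredB; last exact: natr_int.
have I0 x : x \in finsupp nu -> inI0 n x.1 by move=> /nuI /andP[].
apply: half_sum_int => [x y xs ys|x y xs ys|x xs].
- by rewrite (form_sym _ (I0 _ xs) (I0 _ ys)) minnC mulnAC.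
- have [z] := form_tch_int X x.2 y.2 (I0 _ xs) (I0 _ ys).
  rewrite !natrM !mulrA => ->.
  by rewrite !rpredM ?intr_int ?natr_int.
- rewrite mulrAC -mulnA natrM mulrA rpredM ?natr_int //.
  exact: form_diag (I0 _ xs).
Qed.

(* Laurent polynomials in q are taken in the field of fractions of Z[q]. *)
Definition qfield := {fraction {poly int}}.

Definition qvar : qfield := tofrac 'X.

Definition qpoch (q : qfield) (k : nat) : qfield :=
  \prod_(1 <= j < k.+1) (1 - q ^+ j).

Definition qbinom (q : qfield) (k m : nat) : qfield :=
  qpoch q k / (qpoch q m * qpoch q (k - m)).

(* Vacancy numbers and charges are integers (see vacancy_int and charge_int),
   so Num.truncn and Num.floor only change their type; in particular truncn
   is exact on nonnegative vacancy numbers. The product may be restricted to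
   the support of nu because the other q-binomials have lower index 0. *)
Definition weight (X : family) (n : nat) (L nu : nmatrix) : qfield :=
  qvar ^ Num.floor (charge X n L nu) *
  \prod_(x <- finsupp nu)
    qbinom (qvar ^+ tvee X n x.1)
           (Num.truncn (vacancy X n L nu x.1 x.2) + nu x) (nu x).

(* The index set is finite: the simple roots being linearly independent, the
   sum over i of i * m_i^(a) is determined for every a. *)
Definition fermionic (X : family) (n : nat) (lam : seq nat) (L : nmatrix) :
    qfield :=
  \sum_(nu \in configs X n lam L) weight X n L nu.

(* Main.v *)
Require Import Defs.
From HB Require Import structures.
From mathcomp Require Import all_boot all_order all_algebra finmap.
From mathcomp Require Import classical_sets fsbigop functions.
From mathcomp Require Import zify ring.

(** Write f(a, i) for the sum over k of min(i, k) m_k^(a). Away from the end of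
the Dynkin diagram the vacancy number is p_i^(a) = l_i^(a) + f(a - 1, i) +
f(a + 1, i) - 2 f(a, i), where l_i^(a) is the contribution of L, and in every
family the conditions at the last three nodes force f(n - 2, i) <= f(n - 3, i).
Hence f(., i) is convex and decreasing beyond the support of L, with an initial
value bounded independently of n, so it is constant from some node K on that
does not depend on n. Then all vacancy numbers beyond K vanish, the columns
K, ..., n - 2 of a configuration coincide, and the last two columns are
determined by column K, which must be zero, arbitrary, supported on even rows
or with even entries according to the kind. As the weight condition says that
p_i^(a) is the number of columns of lambda of height a when i is large, and as
the charge is -1/2 times the sum of t_a^vee m_i^(a) (p_i^(a) + l_i^(a)), the
configurations truncated at K, and their weights, depend only on the kind. *)

Set Implicit Arguments.
Unset Strict Implicit.
Unset Printing Implicit Defensive.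

(* The libraries above shadow [family] and [form]. *)
Import Defs.
Import Order.TTheory GRing.Theory Num.Theory.
Local Open Scope ring_scope.

(** * Column sums *)

(** The quantity f(., i) of a node with column [c]; [T] is meant to lie past the support of [c]. *)
Definition mincol (T : nat) (c : nat -> nat) (i : nat) : nat :=
  (\sum_(k < T) minn i k * c k)%N.

Lemma mincol0 T c : mincol T c 0 = 0%N.
Proof. by rewrite /mincol big1 // => k _; rewrite min0n. Qed.

Lemma eq_mincol T c c' : c =1 c' -> mincol T c =1 mincol T c'.
Proof. by move=> cc' i; apply: eq_bigr => k _; rewrite cc'. Qed.

Lemma mincol_zero T i : mincol T (fun=> 0%N) i = 0%N.
Proof. by rewrite /mincol big1 // => k _; rewrite muln0. Qed.

(** As a function of i, min(i, k) is linear except for a kink at i = k, where its second difference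
    is -1. Hence [mincol] is concave in i and [c] can be read off from it. *)
Lemma mincol_second_diff T c i : (forall k, (T <= k)%N -> c k = 0%N) ->
  (2 * mincol T c i.+1 = mincol T c i + mincol T c i.+2 + c i.+1)%N.
Proof.
move=> cT; have -> : c i.+1 = (\sum_(k < T) (k == i.+1 :> nat) * c k)%N.
  case: (ltnP i.+1 T) => iT; last first.
    by rewrite cT // big1 // => k _; case: eqP => // ki; have := ltn_ord k; lia.
  rewrite (bigD1 (Ordinal iT)) //= eqxx mul1n big1 ?addn0 // => k.
  by rewrite -val_eqE /= => /negPf ->.
rewrite /mincol big_distrr -!big_split; apply: eq_bigr => k _ /=.
by case: eqP => ki; nia.
Qed.

(** Second differences recover every entry except entry 0, which [mincol] does not see because
    min(i, 0) = 0. *)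
Lemma mincol_inj T c c' : (forall k, (T <= k)%N -> c k = 0%N) ->
  (forall k, (T <= k)%N -> c' k = 0%N) -> c 0 = 0%N -> c' 0 = 0%N ->
  mincol T c =1 mincol T c' -> c =1 c'.
Proof.
move=> cT c'T c0 c'0 e [|k]; first by rewrite c0 c'0.
have := mincol_second_diff k cT; have := mincol_second_diff k c'T.
by rewrite !e; lia.
Qed.

(* Abel summation shows that the increments of F at a are at most the sum of
   the l b with b > a, so beyond A the sequence decreases from a value at most
   A * C; being convex there, it can decrease only A * C times. *)
Lemma convex_eventually_const (F l : nat -> nat) (A C n : nat) :
  F 0 = 0%N ->
  (forall a, (0 < a < n)%N -> (2 * F a <= l a + F a.-1 + F a.+1)%N) ->
  ((0 < n)%N -> (F n <= F n.-1)%N) ->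
  (forall a, (A < a)%N -> l a = 0%N) ->
  (\sum_(a < A.+1) l a <= C)%N ->
  forall a, (A + A * C <= a <= n)%N -> F a = F (A + A * C)%N.
Proof.
move=> F0 cvx Fn lA lC.
have tail (a : nat) : (\sum_(a <= b < A.+1) l b <= C)%N.
  apply: leq_trans lC; rewrite -[leqRHS](big_mkord predT).
  case: (leqP a A.+1) => aA; last by rewrite big_geq // ltnW.
  by rewrite (big_cat_nat (leq0n a) aA) leq_addl.
(* Induction on the distance to [n], starting from the last increment, which is not positive. *)
have step a : (a < n)%N -> (F a.+1 <= F a + \sum_(a.+1 <= b < A.+1) l b)%N.
  move=> an; have [k kE] : exists k, n = (a + k).+1 by exists (n - a.+1)%N; lia.
  elim: k a an kE => [|k IH] a an kE.
    by have := Fn; rewrite kE addn0 /=; lia.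
  have := IH a.+1 ltac:(lia) ltac:(lia); have := cvx a.+1 ltac:(lia) => /=.
  case: (ltnP a.+1 A.+1) => aA; first by rewrite [in X in _ -> _ -> X]big_ltn //; lia.
  by rewrite !(@big_geq _ _ _ _ A.+1) ?(lA a.+1) //; lia.
have bnd a : (a <= n)%N -> (F a <= a * C)%N.
  elim: a => [|a IH] an; first by rewrite F0.
  by have := step a an; have := tail a.+1; have := IH (ltnW an); lia.
have dec a : (A <= a < n)%N -> (F a.+1 <= F a)%N.
  by move=> aA; have := step a; rewrite big_geq; lia.
(* By convexity a strict drop after A + k forces one after each earlier node from A on, and each of
   these k drops costs at least 1. *)
have drop k : (A + k < n)%N -> (F (A + k).+1 < F (A + k))%N ->
    (F (A + k) + k <= A * C)%N.
  elim: k => [|k IH] kn d; first by have := bnd A; rewrite addn0 in kn *; lia.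
  have := cvx (A + k).+1 ltac:(lia); rewrite lA /=; last by lia.
  rewrite addnS in kn d *; have := IH ltac:(lia); lia.
have const k : (A + A * C + k <= n)%N -> F (A + A * C + k)%N = F (A + A * C)%N.
  elim: k => [|k IH] kn; first by rewrite addn0.
  rewrite -IH; last lia.
  have := dec (A + A * C + k)%N ltac:(lia).
  (* A strict drop here would require the value 0, which cannot decrease. *)
  have := drop (A * C + k)%N ltac:(lia).
  by rewrite addnS addnA; lia.
move=> a /andP[Ka an]; have -> : a = (A + A * C + (a - (A + A * C)))%N by lia.
by apply: const; lia.
Qed.

(** * The last three nodes of the diagram *)

(** This is [mincol] for the column with all row lengths doubled; it arises between neighbouring
    nodes with different values of [tch]. *)
Definition mincol2 (T : nat) (c : nat -> nat) (i : nat) : nat :=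
  (\sum_(k < T) minn i (2 * k) * c k)%N.

Lemma mincol2_even T c i : mincol2 T c (2 * i) = (2 * mincol T c i)%N.
Proof.
by rewrite /mincol2 /mincol big_distrr; apply: eq_bigr => k _; rewrite /=; nia.
Qed.

Lemma mincol2_odd T c i :
  mincol2 T c (2 * i).+1 = (mincol T c i + mincol T c i.+1)%N.
Proof.
rewrite /mincol2 /mincol -big_split; apply: eq_bigr => k _ /=.
by rewrite -mulnDl; congr (_ * _)%N; lia.
Qed.

(* The vacancy number of node n - 2 + e, where c3, c2, c1, c0 are the columns
   of nodes n - 3, n - 2, n - 1, n and where L vanishes on these nodes. *)
Definition end_vacancy (X : family) (T : nat) (c3 c2 c1 c0 : nat -> nat)
    (e i : nat) : int :=
  let f c := (mincol T c i)%:Z in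
  let g c := (mincol T c (2 * i))%:Z in
  let h c := (mincol2 T c i)%:Z in
  match X, e with
  | AffD, 0 => f c3 + f c1 + f c0 - 2 * f c2
  | _, 0 => f c3 + f c1 - 2 * f c2
  | AffB, 1 => f c2 + g c0 - 2 * f c1
  | AffC, 1 => f c2 + h c0 - 2 * f c1
  | AffD, 1 => f c2 - 2 * f c1
  | TwAodd, 1 => f c2 + 2 * f c0 - 2 * f c1
  | _, 1 => f c2 + f c0 - 2 * f c1
  | AffA, _ => f c1 - 2 * f c0
  | AffB, _ => h c1 - 2 * f c0
  | AffC, _ => g c1 - 2 * f c0
  | AffD, _ => f c2 - 2 * f c0
  | TwAodd, _ => f c1 - 2 * f c0
  | TwAeven, _ => f c1 - f c0
  | TwD, _ => 2 * (f c1 - f c0)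
  end.

Lemma mincol2_zero T c : mincol2 T c 0 = 0%N.
Proof. by rewrite -[0%N]/(2 * 0)%N mincol2_even mincol0. Qed.

Lemma end_vacancy0 X T c3 c2 c1 c0 e : end_vacancy X T c3 c2 c1 c0 e 0 = 0.
Proof.
rewrite /end_vacancy muln0 !mincol0 !mincol2_zero.
by case: X; case: e => [|[|e]]; rewrite ?addr0 ?mulr0 ?subr0.
Qed.

(* At an odd index the bound follows from its even neighbours, mincol being
   concave. *)
Lemma endC_mincol2_le T c3 c2 c1 c0 i : (forall k, (T <= k)%N -> c1 k = 0%N) ->
  (forall i, 0 <= end_vacancy AffC T c3 c2 c1 c0 2 i) ->
  (mincol2 T c0 i <= mincol T c1 i)%N.
Proof.
rewrite /end_vacancy /= => c1T V.
have [k ->] : exists k, i = (odd i + 2 * k)%N.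
  by exists i./2; rewrite mul2n odd_double_half.
have := V k; case: (odd i) => /=; last by rewrite add0n mincol2_even; lia.
rewrite add1n mincol2_odd; have := V k.+1.
have := mincol_second_diff (2 * k) c1T; rewrite mulnS add2n; lia.
Qed.

Lemma endB_mincol_le T c3 c2 c1 c0 i :
  (forall i, 0 <= end_vacancy AffB T c3 c2 c1 c0 2 i) ->
  (mincol T c0 (2 * i) <= mincol T c1 i)%N.
Proof. by rewrite /end_vacancy /= => /(_ (2 * i)%N); rewrite mincol2_even; lia. Qed.

(** Work inwards: node n bounds the term of the last column at node n - 1 by f(n - 1, i), then node
    n - 1 gives f(n - 1, i) <= f(n - 2, i), and node n - 2 gives the claim. At the fork of type D
    both end columns are bounded by half of f(n - 2, i). *)
Lemma end_slope X T c3 c2 c1 c0 i : (forall k, (T <= k)%N -> c1 k = 0%N) ->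
  (forall e i, (e < 3)%N -> 0 <= end_vacancy X T c3 c2 c1 c0 e i) ->
  (mincol T c2 i <= mincol T c3 i)%N.
Proof.
move=> c1T V.
have V0 j : 0 <= end_vacancy X T c3 c2 c1 c0 0 j by exact: V.
have V1 j : 0 <= end_vacancy X T c3 c2 c1 c0 1 j by exact: V.
have V2 j : 0 <= end_vacancy X T c3 c2 c1 c0 2 j by exact: V.
move: (V0 i) (V1 i) (V2 i); case: X {V} V0 V1 V2 => _ _ V2;
  try by rewrite /end_vacancy /=; lia.
- by have := endB_mincol_le i V2; rewrite /end_vacancy /=; lia.
- by have := endC_mincol2_le i c1T V2; rewrite /end_vacancy /=; lia.
Qed.

(** Read [c k] as the number of rows of length k of a partition, with [c 0] equal to 0: the
    partition is empty, arbitrary, or tiled by horizontal or by vertical dominoes. *)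
Definition kind_column (d : kind) (c : nat -> nat) : Prop :=
  match d with
  | KEmpty => forall k, c k = 0%N
  | KSquare => True
  | KH => forall k, odd k -> c k = 0%N
  | KV => forall k, ~~ odd (c k)
  end.

(* The columns of nodes n - 1 and n when the columns of the nodes before them
   are equal to c and when the last vacancy numbers are nonnegative. *)
Definition penult_column (X : family) (c : nat -> nat) (k : nat) : nat :=
  if X is AffD then (c k)./2 else c k.

Definition last_column (X : family) (c : nat -> nat) (k : nat) : nat :=
  match X with
  | AffB => if odd k then 0%N else (c k./2)./2
  | AffC => c (2 * k)%N
  | AffD | TwAodd => (c k)./2
  | _ => c k
  end.

(** Equality of the first two column sums leaves no slack in the estimates of [end_slope]. These
    become equations between column sums, and second differences turn them into equations between
    columns. *)
Lemma end_columns X T c3 c2 c1 c0 :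
  (forall k, (T <= k)%N -> [/\ c2 k = 0, c1 k = 0 & c0 k = 0])%N ->
  [/\ c2 0 = 0, c1 0 = 0 & c0 0 = 0]%N ->
  (forall i, mincol T c3 i = mincol T c2 i) ->
  (forall e i, (e < 3)%N -> 0 <= end_vacancy X T c3 c2 c1 c0 e i) ->
  [/\ kind_column (kind_of X) c2, c1 =1 penult_column X c2
    & c0 =1 last_column X c2].
Proof.
move=> cT [c20 c10 c00] f32 V.
have c2T k : (T <= k)%N -> c2 k = 0%N by case/cT.
have c1T k : (T <= k)%N -> c1 k = 0%N by case/cT.
have c0T k : (T <= k)%N -> c0 k = 0%N by case/cT.
have V0 j : 0 <= end_vacancy X T c3 c2 c1 c0 0 j by exact: V.
have V1 j : 0 <= end_vacancy X T c3 c2 c1 c0 1 j by exact: V.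
have V2 j : 0 <= end_vacancy X T c3 c2 c1 c0 2 j by exact: V.
have diff2 k := mincol_second_diff k c2T.
have diff1 k := mincol_second_diff k c1T.
have diff0 k := mincol_second_diff k c0T.
case: X {V} V0 V1 V2 => V0 V1 V2.
- have e j : (mincol T c2 j = 0 /\ mincol T c1 j = 0 /\ mincol T c0 j = 0)%N.
    by have := V0 j; have := V1 j; have := V2 j; have := f32 j;
       rewrite /end_vacancy /=; lia.
  have z k : (c2 k = 0 /\ c1 k = 0 /\ c0 k = 0)%N.
    case: k => [|k] //; have := diff2 k; have := diff1 k; have := diff0 k.
    by have := e k; have := e k.+1; have := e k.+2; lia.
  by split=> k /=; have := z k; lia.
- have e j : (mincol T c1 j = mincol T c2 j /\ mincol T c0 (2 * j) = mincol T c2 j)%N.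
    have := V0 j; have := V1 j; have := endB_mincol_le j V2; have := f32 j.
    by rewrite /end_vacancy /=; lia.
  (* At an odd index the condition of node n is the reverse of the concavity of [mincol T c0], so
     the second difference vanishes there. *)
  have o j : (c0 (2 * j).+1 = 0)%N.
    have := V2 (2 * j).+1; have := e j; have := e j.+1; have := diff0 (2 * j)%N.
    by rewrite /end_vacancy /= mincol2_odd mulnS add2n; lia.
  (* Since [mincol T c0] is linear at odd indices, its second difference with step 2 at an even
     index is twice the ordinary one. *)
  have d j : (2 * c0 (2 * j) = c2 j)%N.
    case: j => [|j]; first by rewrite muln0 c00 c20.
    have := o j; have := o j.+1; have := e j; have := e j.+1; have := e j.+2.
    have := diff2 j; have := diff0 (2 * j)%N; have := diff0 (2 * j).+1.
    have := diff0 (2 * j).+2.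
    by rewrite !mulnS !add2n; lia.
  split=> k /=.
  + by rewrite -d; lia.
  + apply: (mincol_inj c1T c2T) => // j; have := e j; lia.
  + have [j ->] : exists j, k = (odd k + 2 * j)%N.
      by exists k./2; rewrite mul2n odd_double_half.
    rewrite oddD oddM addbF; case: (odd k); first by rewrite /= add1n o.
    by rewrite add0n /= mul2n doubleK -mul2n -d; lia.
- have e j : (mincol T c1 j = mincol T c2 j /\ mincol2 T c0 j = mincol T c2 j)%N.
    have := V0 j; have := V1 j; have := endC_mincol2_le j c1T V2; have := f32 j.
    by rewrite /end_vacancy /=; lia.
  have f0 j : (2 * mincol T c0 j = mincol T c2 (2 * j))%N.
    by have := e (2 * j)%N; rewrite mincol2_even; lia.
  (* [mincol2] at an odd index is the mean of its two neighbours, so [mincol T c2], which equals it,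
     is linear there. *)
  have o j : (c2 (2 * j).+1 = 0)%N.
    have := e (2 * j).+1; have := f0 j; have := f0 j.+1; have := diff2 (2 * j)%N.
    by rewrite mincol2_odd mulnS add2n; lia.
  split=> k /=.
  + by move=> ok; rewrite -(odd_double_half k) ok -mul2n add1n o.
  + apply: (mincol_inj c1T c2T) => // j; have := e j; lia.
  + case: k => [|j]; first by rewrite muln0 c00 c20.
    have := o j; have := o j.+1; have := f0 j; have := f0 j.+1; have := f0 j.+2.
    have := diff0 j; have := diff2 (2 * j)%N; have := diff2 (2 * j).+1.
    have := diff2 (2 * j).+2.
    by rewrite !mulnS !add2n; lia.
- have e j : (2 * mincol T c1 j = mincol T c2 j /\ 2 * mincol T c0 j = mincol T c2 j)%N.
    by have := V0 j; have := V1 j; have := V2 j; have := f32 j;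
       rewrite /end_vacancy /=; lia.
  have z k : (2 * c1 k = c2 k /\ 2 * c0 k = c2 k)%N.
    case: k => [|k]; first by lia.
    have := diff2 k; have := diff1 k; have := diff0 k.
    by have := e k; have := e k.+1; have := e k.+2; lia.
  by split=> k /=; have := z k; lia.
- have e j : (mincol T c1 j = mincol T c2 j /\ 2 * mincol T c0 j = mincol T c2 j)%N.
    by have := V0 j; have := V1 j; have := V2 j; have := f32 j;
       rewrite /end_vacancy /=; lia.
  have z k : (c1 k = c2 k /\ 2 * c0 k = c2 k)%N.
    case: k => [|k]; first by lia.
    have := diff2 k; have := diff1 k; have := diff0 k.
    by have := e k; have := e k.+1; have := e k.+2; lia.
  by split=> k /=; have := z k; lia.
- have e j : (mincol T c1 j = mincol T c2 j /\ mincol T c0 j = mincol T c2 j)%N.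
    by have := V0 j; have := V1 j; have := V2 j; have := f32 j;
       rewrite /end_vacancy /=; lia.
  by split=> //; [apply: (mincol_inj c1T c2T)|apply: (mincol_inj c0T c2T)] => // j;
    have := e j; lia.
- have e j : (mincol T c1 j = mincol T c2 j /\ mincol T c0 j = mincol T c2 j)%N.
    by have := V0 j; have := V1 j; have := V2 j; have := f32 j;
       rewrite /end_vacancy /=; lia.
  by split=> //; [apply: (mincol_inj c1T c2T)|apply: (mincol_inj c0T c2T)] => // j;
    have := e j; lia.
Qed.

Lemma sum_even_odd (M : nat) (F : nat -> nat) :
  (\sum_(k < 2 * M) F k = \sum_(k < M) (F (2 * k) + F (2 * k).+1))%N.
Proof.
elim: M => [|M IH]; first by rewrite muln0 !big_ord0.
by rewrite mulnS add2n !big_ord_recr /= IH addnA.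
Qed.

Lemma sum_vanish_widen (M : nat) (F : nat -> nat) :
  (forall k, (M <= k)%N -> F k = 0%N) ->
  (\sum_(k < 2 * M) F k = \sum_(k < M) F k)%N.
Proof.
move=> FM; rewrite -!(big_mkord xpredT F) (@big_cat_nat _ _ _ M) //=; last by lia.
by rewrite [X in (_ + X)%N]big_nat_cond [X in (_ + X)%N]big1 ?addn0 // => k;
  case/andP => /andP[/FM ->].
Qed.

(** Converse to [end_columns]. The bound is doubled because in [AffB] the rows of the last column
    are twice as long as those of [c]. *)
Lemma end_vacancy_columns X M c e i : (forall k, (M <= k)%N -> c k = 0%N) ->
  kind_column (kind_of X) c ->
  end_vacancy X (2 * M) c c (penult_column X c) (last_column X c) e i = 0.
Proof.
move=> cM kc.
have half (h : nat -> nat) : (forall k, ~~ odd (c k)) ->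
    (2 * (\sum_(k < 2 * M) h k * (c k)./2) = \sum_(k < 2 * M) h k * c k)%N.
  move=> ce; rewrite big_distrr; apply: eq_bigr => k _ /=.
  by rewrite mulnCA; congr (_ * _)%N; have := ce k; lia.
have widen (h : nat -> nat) :
    (\sum_(k < 2 * M) h k * c k = \sum_(k < M) h k * c k)%N.
  by apply: (@sum_vanish_widen M (fun k => h k * c k)%N) => k /cM ->; rewrite muln0.
case: X kc => kc; rewrite /end_vacancy /penult_column /last_column.
- rewrite /= in kc; have z : mincol (2 * M) c i = 0%N.
    by rewrite (eq_mincol _ kc) mincol_zero.
  by rewrite z; case: e => [|[|]].
- rewrite /= in kc.
  have S (h : nat -> nat) : (2 * \sum_(k < 2 * M)
      h k * (if odd k then 0 else (c k./2)./2) = \sum_(k < 2 * M) h (2 * k) * c k)%N.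
    rewrite (sum_even_odd M (fun k => h k * (if odd k then 0 else (c k./2)./2))%N).
    rewrite (widen (fun k => h (2 * k)%N)) big_distrr; apply: eq_bigr => k _ /=.
    rewrite oddM /= muln0 addn0 mulnCA; congr (_ * _)%N.
    have -> : ((2 * k)./2 = k)%N by lia.
    by have := kc k; lia.
  have S1 := S (minn (2 * i)); have S0 := S (minn i).
  have S2 : (\sum_(k < 2 * M) minn (2 * i) (2 * k) * c k = 2 * mincol (2 * M) c i)%N.
    exact: mincol2_even.
  by move: S1 S0 S2; rewrite /mincol /mincol2; case: e => [|[|e]]; lia.
- rewrite /= in kc.
  have S (h : nat -> nat) : (\sum_(k < 2 * M) h k * c k =
      \sum_(k < 2 * M) h (2 * k) * c (2 * k))%N.
    rewrite (sum_even_odd M (fun k => h k * c k)%N) (@sum_vanish_widen M (fun k => h (2 * k) * c (2 * k)))%N.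
      by apply: eq_bigr => k _; rewrite [c _.+1]kc ?muln0 ?addn0 //= oddM.
    by move=> k Mk; rewrite cM ?muln0 //; lia.
  have S1 := S (minn i); have S0 := S (minn (2 * i)).
  have S2 : (\sum_(k < 2 * M) minn (2 * i) (2 * k) * c (2 * k)
      = 2 * mincol (2 * M) (fun k => c (2 * k)%N) i)%N.
    exact: mincol2_even.
  by move: S1 S0 S2; rewrite /mincol /mincol2; case: e => [|[|e]]; lia.
- by have := half (minn i) kc; rewrite /mincol; case: e => [|[|e]]; lia.
- by have := half (minn i) kc; rewrite /mincol; case: e => [|[|e]]; lia.
- by rewrite /mincol; case: e => [|[|e]]; lia.
- by rewrite /mincol; case: e => [|[|e]]; lia.
Qed.

(** * Vacancy numbers *)

Lemma big_support (R : Type) (idx : R) (op : Monoid.com_law idx) (I : eqType)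
    (r1 r2 : seq I) (F : I -> R) : uniq r1 -> uniq r2 ->
  (forall x, x \in r1 -> x \notin r2 -> F x = idx) ->
  (forall x, x \in r2 -> x \notin r1 -> F x = idx) ->
  \big[op/idx]_(x <- r1) F x = \big[op/idx]_(x <- r2) F x.
Proof.
move=> u1 u2 F1 F2; rewrite (bigID (mem r2)) /= [RHS](bigID (mem r1)) /=.
rewrite [X in op _ X = _]big_seq_cond [X in op _ X = _]big1; last first.
  by move=> x /andP[]; exact: F1.
rewrite [X in _ = op _ X]big_seq_cond [X in _ = op _ X]big1; last first.
  by move=> x /andP[]; exact: F2.
rewrite !Monoid.mulm1 -[LHS]big_filter -[RHS]big_filter; apply: perm_big.
apply: uniq_perm; rewrite ?filter_uniq // => x.
by rewrite !mem_filter andbC.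
Qed.

Lemma sum_columns (V : nmodType) (nu : nmatrix) (s : seq nat) (T : nat)
    (F : nat * nat -> V) : uniq s ->
  (forall x, nu x = 0%N -> F x = 0) ->
  (forall x, x \in finsupp nu -> (x.2 < T)%N) ->
  (forall x, x \in finsupp nu -> x.1 \notin s -> F x = 0) ->
  \sum_(x <- finsupp nu) F x = \sum_(b <- s) \sum_(k < T) F (b, k : nat).
Proof.
move=> us F0 nuT Fs.
under [RHS]eq_bigr do rewrite -(big_mkord xpredT (fun k => F (_, k))).
rewrite -(big_allpairs (F := F)); apply: big_support => [||[b k] bk|[b k] _].
- exact: fset_uniq.
- by apply: allpairs_uniq; rewrite ?iota_uniq // => -[? ?] [].
- move=> bkN; apply: Fs => //; apply: contraNN bkN => /= bs.
  by apply: allpairs_f => //; rewrite mem_index_iota (nuT _ bk).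
- by rewrite memNfinsupp => /eqP /F0.
Qed.

Definition lsum (L : nmatrix) (a i : nat) : nat :=
  (\sum_(x <- finsupp L | x.1 == a) L x * minn i x.2)%N.

Definition column (nu : nmatrix) (a k : nat) : nat := nu (a, k).

Lemma vacancy_cols X n (L nu : nmatrix) a i s T : uniq s ->
  (forall x, x \in finsupp nu -> (x.2 < T)%N) ->
  (forall x, x \in finsupp nu -> x.1 \notin s -> form X n a x.1 = 0) ->
  vacancy X n L nu a i = (lsum L a i)%:R - (tvee X n a)%:R^-1 * \sum_(b <- s)
    form X n a b *
    (\sum_(k < T) minn (tch X n b * i) (tch X n a * k) * column nu b k)%N%:R.
Proof.
move=> us nuT nus; rewrite /vacancy -/(lsum L a i); congr (_ - _ * _).
rewrite (sum_columns us _ nuT) => [|x nx0|x xnu xs].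
- by apply: eq_bigr => b _; rewrite natr_sum mulr_sumr; apply: eq_bigr.
- by rewrite nx0 muln0 mulr0.
- by rewrite nus // mul0r.
Qed.

Lemma cartan_bulk T n a b : (a.+2 < n)%N -> (b <= n)%N ->
  cartan T n a b = if a == b then 2 else - ((a.+1 == b) || (b.+1 == a))%:Z.
Proof.
move=> an bn; rewrite /cartan; have -> : (a == n) = false by lia.
have -> : (a.+2 == n) = false by lia.
case: eqP => // ab; case: T => //; case: eqP => // ->.
- by have -> : (a.+1 == n) || (n.+1 == a) = false by lia.
- by have -> : (a.+1 == n) || (n.+1 == a) = false by lia.
Qed.

Lemma tvee_neq0 X n a : (tvee X n a)%:R != 0 :> rat.
Proof. by case: X => //=; case: ifP. Qed.

Lemma tch_neq0 X n a : (tch X n a)%:R != 0 :> rat.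
Proof. by case: X => //=; case: ifP. Qed.

(** Away from the end every diagram looks like type A, and half the square length of a root is
    t_a^vee / t_a. Both factors cancel in the vacancy number, which therefore takes the same form in
    all families. *)
Lemma form_bulk X n a b : (a.+2 < n)%N -> (b <= n)%N ->
  form X n a b = (tvee X n a)%:R / (tch X n a)%:R *
    (if a == b then 2 else - ((a.+1 == b) || (b.+1 == a))%:R).
Proof.
move=> an bn; rewrite /form cartan_bulk //.
have aN : (a == n) = false by lia.
have aL : (a < n)%N by lia.
set d := (_ || _); have -> : (if a == b then 2 else - d%:Z)%:~R =
    (if a == b then 2 else - d%:R) :> rat.
  by case: ifP => // _; case: d.
move: (if _ then _ else _) => v.
by case: X => /=; rewrite /sqlen /= ?aN ?aL /=; field.
Qed.

Lemma tch_bulk X n a b : (a < n)%N -> (b < n)%N -> tch X n a = tch X n b.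
Proof. by move=> an bn; case: X => //=; do ?case: ifP; lia. Qed.

(** For a = 1 the formula involves a column at node 0, which is zero for matrices indexed by I_0. *)
Lemma vacancy_bulk X n (L nu : nmatrix) a i T : (0 < a)%N -> (a.+2 < n)%N ->
  (forall x, x \in finsupp nu -> (x.1 <= n)%N && (x.2 < T)%N) ->
  vacancy X n L nu a i =
    ((lsum L a i)%:Z + (mincol T (column nu a.-1) i)%:Z
     + (mincol T (column nu a.+1) i)%:Z - 2 * (mincol T (column nu a) i)%:Z)%:~R.
Proof.
move=> a0 an nuT.
rewrite (@vacancy_cols _ _ _ _ _ _ [:: a.-1; a; a.+1] T); first last.
- move=> x /nuT /andP[xn _]; rewrite !inE => xa; rewrite form_bulk //.
  have -> : (a == x.1) = false by lia.
  have -> : (a.+1 == x.1) || (x.1.+1 == a) = false by lia.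
  by rewrite oppr0 mulr0.
- by move=> x /nuT /andP[].
- by rewrite /= !inE; lia.
rewrite !big_cons big_nil addr0.
rewrite !form_bulk; try lia.
rewrite (@tch_bulk _ _ a.-1 a) ?(@tch_bulk _ _ a.+1 a); try lia.
have mE b : (\sum_(k < T) minn (tch X n a * i) (tch X n a * k) * column nu b k
    = tch X n a * mincol T (column nu b) i)%N.
  by rewrite big_distrr; apply: eq_bigr => k _; rewrite /= -minnMr mulnA.
rewrite !mE !natrM eqxx.
have -> : (a == a.-1) = false by lia.
have -> : (a == a.+1) = false by lia.
have -> : (a.+1 == a.-1) || (a.-1.+1 == a) = true by lia.
rewrite eqxx /=; rewrite !(rmorphD, rmorphB, rmorphM, rmorphN) /= -!pmulrn.
by field; rewrite tvee_neq0 tch_neq0.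
Qed.

Lemma vacancy_end X m (L nu : nmatrix) e i T : (e < 3)%N ->
  (forall x, x \in finsupp nu -> (x.1 <= m.+3)%N && (x.2 < T)%N) ->
  vacancy X m.+3 L nu (e + m.+1) i = (lsum L (e + m.+1) i)%:R +
    (end_vacancy X T (column nu m) (column nu m.+1) (column nu m.+2) (column nu m.+3) e i)%:~R.
Proof.
move=> e3 nuT.
(* Once [e] is fixed, every comparison of nodes is between shifts of [m]; these two tables decide
   them all. *)
have eqF : ((m == m.+1) = false) * ((m == m.+2) = false) * ((m == m.+3) = false)
  * ((m == m.+4) = false) * ((m == m.+4.+1) = false)
  * ((m.+1 == m) = false) * ((m.+2 == m) = false) * ((m.+3 == m) = false)
  * ((m.+4 == m) = false) * ((m.+4.+1 == m) = false) by do !split; lia.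
have ltT : ((m.+1 < m.+3) = true)%N * ((m.+2 < m.+3) = true)%N * ((m < m.+3) = true)%N
  * ((m.+3 < m.+3) = false)%N by do !split; lia.
rewrite (@vacancy_cols _ _ _ _ _ _ [:: m; m.+1; m.+2; m.+3] T); first last.
- move=> x /nuT /andP[xn _]; rewrite !inE => xm; have {xn xm} xm : (x.1 < m)%N by lia.
  have xF : ((m.+1 == x.1) = false) * ((m.+2 == x.1) = false)
    * ((m.+3 == x.1) = false) * ((m.+4 == x.1) = false) * ((x.1.+1 == m.+1) = false)
    * ((x.1.+1 == m.+2) = false) * ((x.1.+1 == m.+3) = false)
    * ((x.1 == m.+3) = false) * ((x.1.+2 == m.+3) = false) by do !split; lia.
  rewrite /form /cartan; case: e e3 => [|[|[|]]] //= _;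
    rewrite ?add0n ?add1n ?add2n ?xF; case: X => /=;
    by rewrite ?eqSS ?eqF ?eqxx ?oppr0 ?mul0rn !mul0r.
- by move=> x /nuT /andP[].
- by rewrite /= !inE !eqSS !eqF.
rewrite !big_cons big_nil addr0; congr (_ + _).
have mE a b : (\sum_(k < T) minn (a * i) (a * k) * column nu b k
    = a * mincol T (column nu b) i)%N.
  by rewrite big_distrr; apply: eq_bigr => k _; rewrite /= -minnMr mulnA.
have m1 b := mE 1%N b; have m2 b := mE 2%N b.
have m12 b : (\sum_(k < T) minn (1 * i) (2 * k) * column nu b k)%N
    = mincol2 T (column nu b) i.
  by rewrite mul1n.
have m21 b : (\sum_(k < T) minn (2 * i) (1 * k) * column nu b k)%N
    = mincol T (column nu b) (2 * i).
  by apply: eq_bigr => k _; rewrite mul1n.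
case: e e3 => [|[|[|]]] //= _; rewrite ?add0n ?add1n ?add2n;
  rewrite /form /cartan /sqlen /tch /tvee /end_vacancy; case: X => /=;
  rewrite ?eqSS ?eqF ?eqxx ?ltT ?m12 ?m21 ?m1 ?m2 /=;
  rewrite !(natrM, rmorphD, rmorphB, rmorphM, rmorphN, rmorphMn) /= -?pmulrn;
  by field.
Qed.

(** * The weight condition and the charge through vacancy numbers *)

Lemma finsupp_bound (nu : nmatrix) (F : nat * nat -> nat) :
  exists T, forall x, x \in finsupp nu -> (F x < T)%N.
Proof.
exists (\max_(x <- finsupp nu) F x).+1 => x xnu; rewrite ltnS.
exact: (@leq_bigmax_seq _ _ xpredT).
Qed.

(** The product of t_a with half the square length is t_a^vee, except at node n of A_{2n}^(2), where
    it is half of that; [eps] is 2 exactly there. *)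
Lemma form_cartan X n a b : inI0 n a ->
  (tvee X n a)%:R^-1 * (form X n a b * (tch X n a)%:R)
  = (cartan (gbar X) n a b)%:~R / (eps X n a)%:R.
Proof.
rewrite /inI0 /form /sqlen => /andP[_ an]; move: (_%:~R) => c.
by case: X => /=; case: (ltngtP a n) an => //= _ _; field.
Qed.

Lemma vacancy_limit X n (L nu : nmatrix) a : inI0 n a ->
  exists i0, forall i, (i0 <= i)%N -> vacancy X n L nu a i =
    (\sum_(x <- finsupp L | x.1 == a) x.2 * L x)%N%:R -
    (\sum_(x <- finsupp nu) cartan (gbar X) n a x.1 *+ (x.2 * nu x))%:~R
    / (eps X n a)%:R.
Proof.
move=> aI; have [TL TLP] := finsupp_bound L snd.
have [T TP] := finsupp_bound nu snd.
(* As t_a <= 2 and k < T, every minimum is then attained by the term without i. *)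
exists (TL + 2 * T)%N => i iT; rewrite /vacancy; congr (_%:R - _).
  rewrite /lsum big_seq_cond [RHS]big_seq_cond; apply: eq_bigr => x /andP[/TLP xT _].
  rewrite mulnC (minn_idPr _) //.
  exact: leq_trans (ltnW xT) (leq_trans (leq_addr _ _) iT).
rewrite rmorph_sum mulr_sumr mulr_suml; apply: eq_big_seq => x /TP xT.
have -> : minn (tch X n x.1 * i) (tch X n a * x.2) = (tch X n a * x.2)%N.
  have t0 b : (0 < tch X n b)%N by case: X => //=; case: ifP.
  have t2 b : (tch X n b <= 2)%N by case: X {t0} => //=; case: ifP.
  apply/minn_idPr; apply: leq_trans (leq_pmull i (t0 x.1)).
  by apply: leq_trans (leq_mul (t2 a) (ltnW xT)) (leq_trans (leq_addl _ _) iT).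
rewrite -mulnA natrM [form _ _ _ _ * _]mulrA mulrA form_cartan //.
by rewrite rmorphMn /= mulrAC mulr_natr.
Qed.

(** By [vacancy_limit] the eventual vacancy number at a is, up to [eps], a coordinate of the weight
    equation. The equation between vectors of length n thus splits into conditions at single
    nodes. *)
Lemma config_vacancyE X n lam (L nu : nmatrix) :
  (forall x, x \in finsupp nu -> inI0 n x.1 && (0 < x.2)%N) ->
  is_config X n lam L nu <-> (forall a, inI0 n a -> exists i0, forall i, (i0 <= i)%N ->
    vacancy X n L nu a i = (ncols lam a)%:R).
Proof.
move=> nuI.
pose mu a := (\sum_(x <- finsupp L | x.1 == a) x.2 * L x)%N.
pose w a : int := \sum_(x <- finsupp nu) cartan (gbar X) n a x.1 *+ (x.2 * nu x).
have wE (j : 'I_n) : (\sum_(x <- finsupp nu) simple_root X n x.1 *+ (x.2 * nu x)) 0 j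
    = w j.+1.
  by rewrite summxE; apply: eq_bigr => x _; rewrite mulmxnE mxE.
have iotaE (j : 'I_n) (v : 'rV[int]_n) : iota_wt X v 0 j = v 0 j *+ eps X n j.+1.
  rewrite /iota_wt summxE (bigD1 j) //= big1 ?addr0 => [|k kj].
    by rewrite !mxE mulmxnE mxE eqxx mulrnAr mulr1.
  rewrite !mxE mulmxnE mxE eqSS [j == k :> nat]eq_sym.
  by rewrite (inj_eq val_inj) (negPf kj) mul0rn mulr0.
have muE (j : 'I_n) : (\sum_(x <- finsupp L | inI0 n x.1) fundwt n x.1 *+ (x.2 * L x)
    - part_wt n lam) 0 j = (mu j.+1)%:Z - (ncols lam j.+1)%:Z.
  rewrite !mxE; congr (_ - _).
    rewrite summxE /mu -natz natr_sum [LHS]big_mkcond [RHS]big_mkcond.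
    apply: eq_bigr => x _; rewrite mulmxnE mxE [x.1 == _]eq_sym.
    case: eqP => [<-|_] /=; last by rewrite mul0rn if_same.
    by rewrite /inI0 ltn_ord.
  rewrite /part_wt summxE (bigD1_seq j.+1) ?iota_uniq ?mem_index_iota ?ltnS ?ltn_ord //=.
  rewrite mulmxnE mxE eqxx big1 ?addr0 ?natz // => k kj.
  by rewrite mulmxnE mxE eq_sym (negPf kj) mul0rn.
have limE a : inI0 n a -> (exists i0, forall i, (i0 <= i)%N ->
    vacancy X n L nu a i = (ncols lam a)%:R) <->
    w a = ((mu a)%:Z - (ncols lam a)%:Z) *+ eps X n a.
  move=> aI; have [i1 i1P] := vacancy_limit X L nu aI.
  have e0 : (eps X n a)%:R != 0 :> rat by case: (X) => //=; case: ifP.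
  have key : ((mu a)%:R - (w a)%:~R / (eps X n a)%:R == (ncols lam a)%:R :> rat)
      = (w a == ((mu a)%:Z - (ncols lam a)%:Z) *+ eps X n a).
    rewrite -(eqr_int rat) rmorphMn rmorphB /= -!pmulrn -mulr_natr.
    by apply/eqP/eqP => [<-|->]; field.
  split=> [[i0 i0P]|wa].
    by apply/eqP; rewrite -key -(i1P (i0 + i1)%N) ?leq_addl // i0P ?leq_addr.
  by exists i1 => i /i1P ->; apply/eqP; rewrite key; apply/eqP.
split=> [[_ /rowP e] a aI|e].
  apply/(limE a aI); have /andP[a0 an] := aI.
  have aE : a = (Ordinal (ltac:(lia) : a.-1 < n)%N).+1 by rewrite /= prednK.
  by move: (e (Ordinal (ltac:(lia) : a.-1 < n)%N)); rewrite wE iotaE muE -aE.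
split=> //; apply/rowP => j; rewrite wE iotaE muE; apply/limE; first exact: ltn_ord.
by apply: e; exact: ltn_ord.
Qed.

(** Solving the definition of the vacancy number for the quadratic form leaves a single sum, to
    which a node with p = l = 0 contributes nothing. *)
Lemma charge_vacancy X n (L nu : nmatrix) :
  charge X n L nu = - 2^-1 * \sum_(x <- finsupp nu)
    (tvee X n x.1)%:R * (nu x)%:R * (vacancy X n L nu x.1 x.2 + (lsum L x.1 x.2)%:R).
Proof.
rewrite /charge.
have -> : (\sum_(x <- finsupp L) \sum_(y <- finsupp nu | y.1 == x.1)
      tvee X n x.1 * (minn x.2 y.2 * L x * nu y))%N%:R
  = \sum_(x <- finsupp nu) (tvee X n x.1)%:R * (nu x)%:R * (lsum L x.1 x.2)%:R :> rat.
  rewrite (exchange_big_dep xpredT) //= natr_sum; apply: eq_bigr => y _.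
  rewrite -!natrM; congr _%:R; rewrite /lsum big_distrr /=.
  rewrite [LHS](eq_bigl (fun x => x.1 == y.1)); last by move=> x; exact: eq_sym.
  by apply: eq_bigr => x /eqP ->; rewrite minnC; ring.
have -> : \sum_(x <- finsupp nu) \sum_(y <- finsupp nu) form X n x.1 y.1 *
    (minn (tch X n y.1 * x.2) (tch X n x.1 * y.2) * nu x * nu y)%N%:R =
  \sum_(x <- finsupp nu) (tvee X n x.1)%:R * (nu x)%:R *
    ((lsum L x.1 x.2)%:R - vacancy X n L nu x.1 x.2) :> rat.
  apply: eq_bigr => x _; rewrite /vacancy -/(lsum L x.1 x.2) subKr.
  rewrite mulrACA mulrA divff ?tvee_neq0 // mul1r mulr_sumr; apply: eq_bigr => y _.
  by rewrite !natrM; ring.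
rewrite !mulr_sumr -sumrB; apply: eq_bigr => x _.
by field.
Qed.

(** * Stable configurations *)

Definition height (nu : nmatrix) : nat := (\max_(x <- finsupp nu) x.2).+1.

Lemma height_finsupp nu x : x \in finsupp nu -> (x.2 < height nu)%N.
Proof. by move=> xnu; rewrite ltnS; exact: (@leq_bigmax_seq _ _ xpredT). Qed.

Lemma column_height nu a k : (height nu <= k)%N -> column nu a k = 0%N.
Proof.
move=> hk; rewrite /column; case: finsuppP => // /height_finsupp /=.
by rewrite ltnNge hk.
Qed.

Definition supported_on (n : nat) (nu : nmatrix) : Prop :=
  forall x : nat * nat, x \in finsupp nu -> inI0 n x.1 && (0 < x.2)%N.

Lemma supported_on_eq0 n nu x : supported_on n nu ->
  ~~ (inI0 n x.1 && (0 < x.2)%N) -> nu x = 0%N.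
Proof. by move=> nuI xI; case: finsuppP => // /nuI; rewrite (negPf xI). Qed.

Definition truncate (K : nat) (nu : nmatrix) : nmatrix :=
  [fsfun x in finsupp nu => if (x.1 <= K)%N then nu x else 0%N | 0%N].

Lemma truncateE K nu x : truncate K nu x = if (x.1 <= K)%N then nu x else 0%N.
Proof. by rewrite fsfunE; case: finsuppP => //; rewrite if_same. Qed.

Lemma truncate_supported_on n K nu :
  supported_on n nu -> supported_on K (truncate K nu).
Proof.
move=> nuI x; rewrite mem_finsupp truncateE.
case: ifP => // xK nux; have /nuI : x \in finsupp nu by rewrite mem_finsupp.
by rewrite /inI0 xK => /andP[/andP[-> _]].
Qed.

Definition extend_fun (X : family) (n K : nat) (nu : nmatrix) (x : nat * nat) : nat :=
  if (x.1 <= K)%N then nu x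
  else if (x.1.+2 <= n)%N then column nu K x.2
  else if x.1.+1 == n then penult_column X (column nu K) x.2
  else if x.1 == n then last_column X (column nu K) x.2
  else 0%N.

(** The box has twice the height of [nu] to hold the last column of [AffB], whose rows are
    doubled. *)
Definition extend (X : family) (n K : nat) (nu : nmatrix) : nmatrix :=
  [fsfun x in [fset x in allpairs pair (iota 0 n.+1) (iota 0 (2 * height nu))]%fset
     => extend_fun X n K nu x | 0%N].

Lemma extendE X n K nu x : supported_on K nu -> (K <= n)%N ->
  extend X n K nu x = extend_fun X n K nu x.
Proof.
move=> nuK Kn; rewrite /extend fsfunE in_fset; case: ifPn => // xN; symmetry.
have {xN} : (n < x.1)%N \/ (2 * height nu <= x.2)%N.
  case: (ltnP n x.1) => xn; first by left.
  case: (leqP (2 * height nu) x.2) => xh; first by right.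
  case/negP: xN; apply/allpairsP; exists x.
  by rewrite !mem_iota !add0n -surjective_pairing; split.
rewrite /extend_fun; case=> [xn|xh].
  have -> : (x.1 <= K)%N = false by lia.
  have -> : (x.1.+1 < n)%N = false by lia.
  have -> : (x.1.+1 == n) = false by lia.
  by have -> : (x.1 == n) = false by lia.
have colx b : column nu b x.2 = 0%N by apply: column_height; lia.
have colx2 b : column nu b (2 * x.2)%N = 0%N by apply: column_height; lia.
have colh b : column nu b x.2./2 = 0%N by apply: column_height; lia.
have -> : nu x = 0%N by rewrite [x]surjective_pairing; exact: colx.
by rewrite /penult_column /last_column !colx !colx2 !colh; case: X; rewrite ?if_same.
Qed.

Lemma extend_column_bulk X n K nu b : supported_on K nu -> (K.+2 <= n)%N ->
  (b.+2 <= n)%N -> column (extend X n K nu) b = column nu (minn b K).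
Proof.
move=> nuK Kn bn; apply: boolp.funext => k.
rewrite /column extendE //; last lia.
by rewrite /extend_fun /= bn; case: (leqP b K).
Qed.

Lemma extend_column_penult X m K nu : supported_on K nu -> (K <= m)%N ->
  column (extend X m.+3 K nu) m.+2 = penult_column X (column nu K).
Proof.
move=> nuK Km; apply: boolp.funext => k.
rewrite /column extendE //; last lia.
rewrite /extend_fun /= eqxx.
have -> : (m.+2 <= K)%N = false by lia.
by have -> : (m.+3 < m.+3)%N = false by lia.
Qed.

Lemma extend_column_last X m K nu : supported_on K nu -> (K <= m)%N ->
  column (extend X m.+3 K nu) m.+3 = last_column X (column nu K).
Proof.
move=> nuK Km; apply: boolp.funext => k.
rewrite /column extendE //; last lia.
rewrite /extend_fun /= eqxx.
have -> : (m.+3 <= K)%N = false by lia.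
have -> : (m.+4 < m.+3)%N = false by lia.
by have -> : (m.+4 == m.+3) = false by lia.
Qed.

Lemma extend_supported_on X n K nu : supported_on K nu -> (0 < K)%N ->
  (K <= n)%N -> supported_on n (extend X n K nu).
Proof.
move=> nuK K0 Kn x; rewrite mem_finsupp extendE // => ex.
have x1 : inI0 n x.1.
  rewrite /inI0; case: (posnP x.1) => [x0|x0].
    by move: ex; rewrite /extend_fun x0 (supported_on_eq0 nuK) ?x0.
  by case: (leqP x.1 n) => // xn; move: ex; rewrite /extend_fun;
    do ![case: ifP => [?|_]; first lia]; rewrite eqxx.
rewrite x1 lt0n; apply: contraNN ex => /eqP x20.
have c0 b : column nu b 0 = 0%N by apply: (supported_on_eq0 nuK); rewrite andbF.
have nux : nu x = 0%N by apply: (supported_on_eq0 nuK); rewrite x20 andbF.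
rewrite /extend_fun /penult_column /last_column x20 nux muln0 /= !c0.
by case: X; do ?case: ifP.
Qed.

Lemma extend_finsupp X n K nu x : supported_on K nu -> (0 < K)%N -> (K <= n)%N ->
  x \in finsupp (extend X n K nu) -> (x.1 <= n)%N && (x.2 < 2 * height nu)%N.
Proof.
move=> nuK K0 Kn xe; have /andP[/andP[_ ->] _] := extend_supported_on nuK K0 Kn xe.
move: xe; rewrite /extend => /(fsubsetP (finsupp_sub _ _ _)); rewrite in_fset.
by case/allpairsP => y [_]; rewrite mem_iota => /andP[_ y2] ->.
Qed.

(* The vacancy numbers of the extension of nu by columns equal to column K. *)
Definition stable_vacancy (K : nat) (L nu : nmatrix) (a i : nat) : int :=
  let T := (2 * height nu)%N in
  (lsum L a i)%:Z + (mincol T (column nu a.-1) i)%:Z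
  + (mincol T (column nu (minn a.+1 K)) i)%:Z - 2 * (mincol T (column nu a) i)%:Z.

Lemma lsum_eq0 A (L : nmatrix) a i :
  (forall x, x \in finsupp L -> (x.1 <= A)%N) -> (A < a)%N -> lsum L a i = 0%N.
Proof.
move=> LA Aa; rewrite /lsum big_seq_cond big1 // => x /andP[/LA xA /eqP xa].
by move: Aa; rewrite -xa ltnNge xA.
Qed.

(** Beyond K, L vanishes; in the bulk three equal columns cancel, and at the end
    [end_vacancy_columns] applies. At K the next column is column K again. *)
Lemma vacancy_extend X n K A (L nu : nmatrix) a i :
  (forall x, x \in finsupp L -> (x.1 <= A)%N) -> (A < K)%N -> (K.+3 <= n)%N ->
  supported_on K nu -> kind_column (kind_of X) (column nu K) -> inI0 n a ->
  vacancy X n L (extend X n K nu) a i =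
    if (a <= K)%N then (stable_vacancy K L nu a i)%:~R else 0.
Proof.
move=> LA AK Kn nuK kK /andP[a0 an].
have [m nE] : exists m, n = m.+3 by exists (n - 3)%N; lia.
subst n; have K0 : (0 < K)%N by lia.
have eT x := @extend_finsupp X m.+3 K nu x nuK K0 ltac:(lia).
case: (leqP a m) => am.
  rewrite (@vacancy_bulk X m.+3 L _ a i _ a0 _ eT); last lia.
  rewrite !extend_column_bulk; try lia; try by [].
  case: leqP => aK.
    rewrite /stable_vacancy.
    by have -> : minn a.-1 K = a.-1 by lia.
  rewrite (@lsum_eq0 A L) //; last lia.
  have -> : minn a.-1 K = K by lia.
  have -> : minn a.+1 K = K by lia.
  by rewrite -[0 in RHS](mulr0z 1); congr _%:~R; lia.
have -> : (a <= K)%N = false by lia.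
have [e e3 aE] : exists2 e, (e < 3)%N & a = (e + m.+1)%N by exists (a - m.+1)%N; lia.
rewrite {}aE in an am a0 *.
rewrite (@vacancy_end X m L _ e i _ e3 eT) (@lsum_eq0 A L) //; last lia.
rewrite extend_column_last ?extend_column_penult; try lia; try by [].
rewrite !extend_column_bulk; try lia; try by [].
have -> : minn m K = K by lia.
have -> : minn m.+1 K = K by lia.
by rewrite end_vacancy_columns ?addr0 // => k; exact: column_height.
Qed.

(** * The bijection with a model independent of the rank *)

(** The family and the rank enter only through the kind: the condition on column K stands for the
    whole diagram beyond K, and the weight condition has the form of [config_vacancyE]. *)
Definition stable_configs (d : kind) (K : nat) (lam : seq nat) (L : nmatrix) :
    set nmatrix :=
  [set nu | [/\ supported_on K nu, kind_column d (column nu K),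
     forall a i, inI0 K a -> (0 < i)%N -> 0 <= stable_vacancy K L nu a i
   & forall a, inI0 K a -> exists i0, forall i, (i0 <= i)%N ->
       stable_vacancy K L nu a i = (ncols lam a)%:Z]]%classic.

(** Beyond K the vacancy numbers are 0, so admissibility holds there, and so does the weight
    condition, as lambda has no columns of height above A. *)
Lemma extend_config X n K A lam (L nu : nmatrix) :
  (forall x, x \in finsupp L -> (x.1 <= A)%N) ->
  (forall a, (A < a)%N -> ncols lam a = 0%N) ->
  (A < K)%N -> (K.+3 <= n)%N ->
  supported_on K nu -> kind_column (kind_of X) (column nu K) ->
  configs X n lam L (extend X n K nu) <-> stable_configs (kind_of X) K lam L nu.
Proof.
move=> LA lamA AK Kn nuK kK.
have eI : supported_on n (extend X n K nu).
  by apply: extend_supported_on; lia || exact: nuK.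
have vE a i : inI0 n a -> vacancy X n L (extend X n K nu) a i = _ :=
  @vacancy_extend X n K A L nu a i LA AK Kn nuK kK.
have KI a : inI0 K a -> inI0 n a && (a <= K)%N by rewrite /inI0; lia.
rewrite /configs /stable_configs /=; split=> [[/(@config_vacancyE X n lam L _ eI) lim adm]|].
  split=> // a => [i|] aK; have /andP[an aK'] := KI a aK.
    by move=> i0; have := adm a i an i0; rewrite vE // aK' ler0z.
  have [i0 i0P] := lim a an; exists i0 => i /i0P; rewrite vE // aK' pmulrn.
  exact: intr_inj.
case=> _ _ adm lim; split.
  apply/(@config_vacancyE X n lam L _ eI) => a an; case: (leqP a K) => aK.
    have aK' : inI0 K a by move: an; rewrite /inI0 aK; lia.
    by have [i0 i0P] := lim a aK'; exists i0 => i /i0P e; rewrite vE // aK e -pmulrn.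
  by exists 0%N => i _; rewrite vE // leqNgt aK lamA // (ltn_trans AK).
move=> a i an i0; rewrite vE //; case: ifP => // aK; rewrite ler0z adm //.
by move: an; rewrite /inI0 aK; lia.
Qed.

(** [K] is one more than the threshold of [convex_eventually_const], which ensures A < K even when A
    * C = 0. *)
Lemma config_stabilizes X n A C lam (L nu : nmatrix) (K := (A + A * C).+1) :
  (forall x, x \in finsupp L -> (x.1 <= A)%N) ->
  (forall i, (\sum_(a < A.+1) lsum L a i <= C)%N) ->
  (K.+3 <= n)%N -> configs X n lam L nu ->
  kind_column (kind_of X) (column nu K) /\ extend X n K (truncate K nu) = nu.
Proof.
move=> LA LC Kn [[nuI _] adm].
have nuI' : supported_on n nu := nuI.
have [m nE] : exists m, n = m.+3 by exists (n - 3)%N; lia.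
subst n; pose T := height nu.
have nuT (x : nat * nat) : x \in finsupp nu -> (x.1 <= m.+3)%N && (x.2 < T)%N.
  by move=> xnu; rewrite height_finsupp // andbT; have /andP[/andP[]] := nuI x xnu.
have c0 b : column nu b 0 = 0%N by apply: (supported_on_eq0 nuI'); rewrite andbF.
have colT b k : (T <= k)%N -> column nu b k = 0%N := @column_height nu b k.
have col0 k : column nu 0 k = 0%N by apply: (supported_on_eq0 nuI').
have V e i : (e < 3)%N -> 0 <= end_vacancy X T (column nu m) (column nu m.+1)
    (column nu m.+2) (column nu m.+3) e i.
  move=> e3; case: i => [|i]; first by rewrite end_vacancy0.
  have := adm (e + m.+1)%N i.+1; rewrite (@vacancy_end X m L nu e i.+1 T e3 nuT).
  rewrite (@lsum_eq0 A L) //; last by rewrite /K in Kn; lia.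
  by rewrite add0r ler0z; apply=> //; rewrite /inI0; lia.
have const i a : (K <= a <= m.+1)%N ->
    mincol T (column nu a) i = mincol T (column nu K) i.
  (* The last index is node n - 2: vacancies at nodes 1 to n - 3 give convexity, and [end_slope]
     gives the final decrease. *)
  move=> Ka; have F := @convex_eventually_const
    (fun a => mincol T (column nu a) i) (fun a => lsum L a i) A C m.+1.
  have {}F b : (A + A * C <= b <= m.+1)%N -> mincol T (column nu b) i =
      mincol T (column nu (A + A * C)) i.
    apply: F => [|b0 /andP[b00 b0m]|_|b0|] /=.
    - by rewrite (eq_mincol _ col0) mincol_zero.
    (* Admissibility only concerns i > 0; at i = 0 all column sums vanish. *)
    - case: i => [|i]; first by rewrite !mincol0.
      have := adm b0 i.+1; rewrite (@vacancy_bulk X m.+3 L nu b0 i.+1 T b00 _ nuT) //.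
      by rewrite ler0z => /(_ ltac:(rewrite /inI0; lia) isT); lia.
    - exact: end_slope (colT _) V.
    - exact: lsum_eq0.
    - exact: LC.
  by rewrite !F //; rewrite /K in Ka Kn *; lia.
have colE a : (K <= a <= m.+1)%N -> column nu a = column nu K.
  move=> Ka; apply: boolp.funext; apply: (@mincol_inj T) => // [k|k|i];
  [exact: colT|exact: colT|exact: const].
(* As K + 3 <= n, nodes n - 3 and n - 2 both lie in the constant range. *)
have flat i : mincol T (column nu m) i = mincol T (column nu m.+1) i.
  by rewrite !const //; lia.
have [kK c1 c2] := end_columns (fun k Tk => And3 (colT _ k Tk) (colT _ k Tk)
  (colT _ k Tk)) (And3 (c0 _) (c0 _) (c0 _)) flat V.
rewrite colE in kK c1 c2; last by lia.
split=> //; apply/fsfunP => -[b k].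
have tK : supported_on K (truncate K nu) by exact: truncate_supported_on nuI'.
have cK : column (truncate K nu) K = column nu K.
  by apply: boolp.funext => j; rewrite /column truncateE leqnn.
rewrite extendE //; last lia.
rewrite /extend_fun /= cK truncateE /=; case: ifP => [-> //|bK].
case: ifP => bm; first by rewrite -(colE b) //; lia.
rewrite !eqSS; case: eqP => [->|b2]; first exact/esym/c1.
case: eqP => [->|b3]; first exact/esym/c2.
by apply/esym/(supported_on_eq0 nuI'); rewrite /inI0 /=; lia.
Qed.

(** Extension keeps the columns up to K, hence is injective; truncation at K provides preimages by
    [config_stabilizes]. *)
Lemma extend_bij X n A C lam (L : nmatrix) (K := (A + A * C).+1) :
  (forall x, x \in finsupp L -> (x.1 <= A)%N) ->
  (forall i, (\sum_(a < A.+1) lsum L a i <= C)%N) ->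
  (forall a, (A < a)%N -> ncols lam a = 0%N) -> (K.+3 <= n)%N ->
  set_bij (stable_configs (kind_of X) K lam L) (configs X n lam L) (extend X n K).
Proof.
move=> LA LC lamA Kn; have AK : (A < K)%N by rewrite ltnS leq_addr.
split=> [nu nuS | nu nu' /set_mem[nuK _ _ _] /set_mem[nuK' _ _ _] e | nu nuC].
- by have [nuK kK _ _] := nuS; apply/(extend_config LA lamA AK Kn nuK kK).
- apply/fsfunP => x; have := congr1 (fun f : nmatrix => f x) e.
  rewrite !extendE //; try lia; rewrite /extend_fun.
  case: (leqP x.1 K) => // xK _; rewrite (supported_on_eq0 nuK) ?(supported_on_eq0 nuK') //.
    by rewrite /inI0 [(x.1 <= _)%N]leqNgt xK andbF.
  by rewrite /inI0 [(x.1 <= _)%N]leqNgt xK andbF.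
- have [kK e] := config_stabilizes LA LC Kn nuC.
  have tK : supported_on K (truncate K nu).
    by have [[nuI _] _] := nuC; exact: truncate_supported_on (nuI : supported_on n nu).
  exists (truncate K nu) => //; move: nuC; rewrite -{1}e.
  move/(extend_config LA lamA AK Kn tK); apply.
  by case: (kind_of X) kK => //= kK k; rewrite /column truncateE leqnn; exact: kK.
Qed.

(** * Weights of stable configurations *)

(** Within a kind t_a^vee varies only at node n, which lies beyond K. *)
Definition kind_tvee (d : kind) : nat := if d is KSquare then 2 else 1.

Lemma tvee_kind X n a : (a < n)%N -> tvee X n a = kind_tvee (kind_of X).
Proof. by move=> an; case: X => //=; case: ifP => //; lia. Qed.

(** The charge is taken in the form of [charge_vacancy], since the bilinear form in its definition
    depends on the family. *)
Definition stable_weight (d : kind) (K : nat) (L nu : nmatrix) : qfield :=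
  qvar ^ Num.floor (- 2^-1 * \sum_(x <- finsupp nu) (kind_tvee d)%:R * (nu x)%:R *
    ((stable_vacancy K L nu x.1 x.2)%:~R + (lsum L x.1 x.2)%:R) : rat) *
  \prod_(x <- finsupp nu) qbinom (qvar ^+ kind_tvee d)
    (Num.truncn ((stable_vacancy K L nu x.1 x.2)%:~R : rat) + nu x) (nu x).

Lemma qpoch_neq0 t k : (0 < t)%N -> qpoch (qvar ^+ t) k != 0.
Proof.
move=> t0; rewrite /qpoch big_seq prodf_seq_neq0; apply/allP => j.
rewrite mem_index_iota => j1; apply/implyP => _.
rewrite -exprM /qvar -tofracXn -tofrac1 -tofracB tofrac_eq0 subr_eq0 eq_sym.
apply/negP => /eqP/(congr1 (fun p : {poly int} => size p)).
by rewrite size_polyXn size_poly1; nia.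
Qed.

(** This is the factor of an entry with vacancy number 0, as for all nodes beyond K. *)
Lemma qbinom_diag t k : (0 < t)%N -> qbinom (qvar ^+ t) k k = 1.
Proof.
move=> t0; rewrite /qbinom subnn [qpoch _ 0]/qpoch big_geq // mulr1.
by rewrite divff // qpoch_neq0.
Qed.

Lemma weight_extend X n A K (L nu : nmatrix) :
  (forall x, x \in finsupp L -> (x.1 <= A)%N) -> (A < K)%N -> (K.+3 <= n)%N ->
  supported_on K nu -> kind_column (kind_of X) (column nu K) ->
  weight X n L (extend X n K nu) = stable_weight (kind_of X) K L nu.
Proof.
move=> LA AK Kn nuK kK.
have eI : supported_on n (extend X n K nu).
  by apply: extend_supported_on; lia || exact: nuK.
have vE a i : inI0 n a -> vacancy X n L (extend X n K nu) a i = _ :=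
  @vacancy_extend X n K A L nu a i LA AK Kn nuK kK.
have e_nu (x : nat * nat) : (x.1 <= K)%N -> extend X n K nu x = nu x.
  by move=> xK; rewrite extendE //; [rewrite /extend_fun xK|lia].
have nuI (x : nat * nat) : x \in finsupp nu -> inI0 n x.1 && (x.1 <= K)%N.
  by move/nuK => /andP[]; rewrite /inI0; lia.
(* Serves both the sum in the charge and the product of q-binomials. *)
have big_e (R : Type) (idx : R) (op : Monoid.com_law idx) (F : nat * nat -> R) :
    (forall x, inI0 n x.1 -> (K < x.1)%N -> F x = idx) ->
    \big[op/idx]_(x <- finsupp (extend X n K nu)) F x = \big[op/idx]_(x <- finsupp nu) F x.
  move=> F0; apply: big_support; rewrite ?fset_uniq // => x.
    move=> xe xnu; apply: F0; first by have /andP[] := eI _ xe.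
    rewrite ltnNge; apply/negP => xK; move: xe; rewrite mem_finsupp e_nu //.
    by rewrite -mem_finsupp (negPf xnu).
  move=> xnu; rewrite memNfinsupp e_nu; last by have /andP[] := nuI x xnu.
  by move: xnu; rewrite mem_finsupp => /negPf ->.
rewrite /weight /stable_weight charge_vacancy; congr (_ ^ Num.floor (_ * _) * _).
  rewrite big_e => [|x xn Kx].
    apply: eq_big_seq => x xnu; have /andP[xn xK] := nuI x xnu.
    by rewrite vE // xK e_nu // tvee_kind //; apply: leq_ltn_trans xK _; lia.
  by rewrite vE // leqNgt Kx (@lsum_eq0 A L) ?(ltn_trans AK) // addr0 mulr0.
have tv a : (0 < tvee X n a)%N by case: (X) => //=; case: ifP.
rewrite big_e => [|x xn Kx].
  apply: eq_big_seq => x xnu; have /andP[xn xK] := nuI x xnu.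
  by rewrite vE // xK e_nu // tvee_kind //; apply: leq_ltn_trans xK _; lia.
by rewrite vE // leqNgt Kx truncn0 add0n qbinom_diag.
Qed.

Lemma ncols_eq0 lam a : (size lam < a)%N -> ncols lam a = 0%N.
Proof.
move=> la; apply/eqP; rewrite /ncols -leqn0 leqNgt -has_count; apply/hasPn => c _.
by rewrite neq_ltn (leq_ltn_trans (count_size _ _) la).
Qed.

Theorem mainTheorem4 (d : kind) (lam : seq nat) (hlam : is_partition lam)
    (L : nmatrix) :
  exists N : nat, forall g g' : affine,
    kind_of (fam g) = d -> kind_of (fam g') = d ->
    (N <= rk g)%N -> (N <= rk g')%N ->
    fermionic (fam g) (rk g) lam L = fermionic (fam g') (rk g') lam L.
Proof.
have [B LB] := finsupp_bound L fst.
(* [A] bounds both the nodes supporting [L] and the column heights of [lam]. *)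
pose A := (B + size lam)%N.
have LA x : x \in finsupp L -> (x.1 <= A)%N.
  by move/LB => xB; exact: leq_trans (ltnW xB) (leq_addr _ _).
have lamA a : (A < a)%N -> ncols lam a = 0%N.
  by move=> Aa; apply: ncols_eq0; exact: leq_ltn_trans (leq_addl _ _) Aa.
(* Replacing min(i, k) by k gives a bound uniform in i, so that one [K] serves all i. *)
pose C := (\sum_(a < A.+1) \sum_(x <- finsupp L | x.1 == a) L x * x.2)%N.
have LC i : (\sum_(a < A.+1) lsum L a i <= C)%N.
  by do 2!apply: leq_sum => ? _; rewrite leq_mul2l geq_minr orbT.
pose K := (A + A * C).+1.
(* The right-hand side sees the family only through its kind, and the rank not at all. *)
have stable X n : (K.+3 <= n)%N -> fermionic X n lam L =
    \sum_(nu \in stable_configs (kind_of X) K lam L) stable_weight (kind_of X) K L nu.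
  move=> Kn; have bij := extend_bij X LA LC lamA Kn.
  rewrite /fermionic (reindex_fsbig _ _ _ _ bij).
  apply: eq_fsbigr => nu /set_mem[nuK kK _ _].
  by apply: (weight_extend LA) => //; rewrite ltnS leq_addr.
by exists K.+3 => g g' gd gd' Ng Ng'; rewrite !stable // gd gd'.
Qed.
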